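(* Let $l>-1$ and let $\phi:(0,\infty)\to[0,\infty)$ satisfy the regularity assumptions listed in the context, with associated polytropic index function $n(\omega)$. Suppose there is some (arbitrarily small) $\omega_0>0$ such that $n(\omega)\le 3+l$ for all $0<\omega\le\omega_0$. Then every associated solution $(m,\omega)$ of the static spherically symmetric Vlasov-Poisson system $$\frac{dm}{dr}=4\pi r^2\rho(r,\omega),\qquad \frac{d\omega}{dr}=-\frac{m}{r^2},\qquad \rho(r,\omega)=C_l\,r^{2l}g_{l+1/2}(\omega),$$ has finite radius and finite mass, i.e. $R<\infty$ and $\lim_{r\to R^-}m(r)<\infty$.
   Context: Setting: time-independent spherically symmetric solutions of the Vlasov-Poisson system with distribution function $f(\mathcal{E},L^2)=\phi(\mathcal{E})L^{2l}$ for $\mathcal{E}>0$ and $f=0$ for $\mathcal{E}\le 0$, where $l>-1$ is a constant, $\mathcal{E}=E_0-E$ is the binding energy ($E_0$ the cut-off energy), $L$ is the modulus of angular momentum, and $\omega=E_0-V$ is the relative potential ($V$ the Newtonian potential). $m(r)$ is the mass inside radius $r$. Definitions: for $m>-1$ and $\omega>0$, $g_m(\omega)=\int_0^\omega\phi(\mathcal{E})(\omega-\mathcal{E})^m\,d\mathcal{E}$; $C_l=2^{l+3/2}\pi^{3/2}\Gamma(l+1)/\Gamma(l+3/2)$; and the polytropic index function is $n(\omega)=-l+\frac{d\log g_{l+1/2}}{d\log\omega}$ for $\omega>0$. Regularity assumptions on $\phi$: $\phi\ge 0$ is $C^1$ on $(0,\infty)$; $\phi$ and $\phi'$ are bounded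 on compact subsets of $(0,\infty)$; on a neighbourhood of $\mathcal{E}=0$, $\phi(\mathcal{E})\le\mathrm{const}\,\mathcal{E}^k$ for some $k>-1$ and $\phi'(\mathcal{E})\le\mathrm{const}\,\mathcal{E}^{k'}$ for some $k'>-2$; if $l<-1/2$, then in addition $\mathcal{E}\phi'(\mathcal{E})$ is locally Hölder continuous on $(0,\infty)$ with an index strictly greater than $-l-1/2$. Moreover $g_{l+1/2}(\omega)>0$ for all $\omega>0$, so that $n(\omega)$ is defined, and $n$ is $C^1$ on $(0,\infty)$ under these assumptions. Solutions: an associated solution is a solution $(m(r),\omega(r))$ of the ODE system with $m>0$ and $\omega>0$, taken on an interval of radii $r>0$ and extended to the right as far as possible with $\omega>0$. The radius $R\in(0,\infty]$ is the supremum of this interval (the radius beyond which $\rho$ vanishes), and the mass is $\lim_{r\to R^-}m(r)$. *)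

(* Defs.v *)
From HB Require Import structures.
From mathcomp Require Import all_boot all_order all_algebra.
From mathcomp Require Import all_classical all_reals all_analysis.

Set Implicit Arguments.
Unset Strict Implicit.
Unset Printing Implicit Defensive.

Import Order.TTheory GRing.Theory Num.Theory.
Import numFieldNormedType.Exports.

Local Open Scope classical_set_scope.
Local Open Scope ring_scope.

Section vlasov_poisson.
Context {R : realType}.

(* Euler's integral; only meaningful for 0 < s. *)
Definition gamma_fun (s : R) : R :=
  \int[lebesgue_measure]_(t in `]0, +oo[) (t `^ (s - 1) * expR (- t)).

Definition C_const (l : R) : R :=
  2 `^ (l + 3 / 2) * pi `^ (3 / 2) * gamma_fun (l + 1) / gamma_fun (l + 3 / 2).

(* Functions of the binding energy are total; only their values on (0, +oo)
   are ever used. *)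
Definition g_fun (phi : R -> R) (m w : R) : R :=
  \int[lebesgue_measure]_(e in `]0, w[) (phi e * (w - e) `^ m).

(* d log g / d log w is the derivative of t |-> log (g (exp t)) at t = log w. *)
Definition polytropic_index (l : R) (phi : R -> R) (w : R) : R :=
  - l + derive1 (fun t : R => ln (g_fun phi (l + 1 / 2) (expR t))) (ln w).

Definition locally_hoelder_pos (h : R -> R) (a : R) : Prop :=
  forall K : set R, compact K -> K `<=` `]0, +oo[ ->
    exists c : R, forall x y, K x -> K y -> `|h x - h y| <= c * `|x - y| `^ a.

Record regular_phi (l : R) (phi : R -> R) : Prop := {
  phi_ge0 : forall e, 0 < e -> 0 <= phi e ;
  phi_derivable : forall e, 0 < e -> derivable phi e 1 ;
  phi_C1 : forall e, 0 < e -> {for e, continuous (derive1 phi)} ;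
  phi_bounded : forall K : set R, compact K -> K `<=` `]0, +oo[ ->
    [bounded phi e | e in K] ;
  dphi_bounded : forall K : set R, compact K -> K `<=` `]0, +oo[ ->
    [bounded derive1 phi e | e in K] ;
  phi_near0 : exists k c : R,
    -1 < k /\ \forall e \near 0^'+, phi e <= c * e `^ k ;
  dphi_near0 : exists k' c : R,
    -2 < k' /\ \forall e \near 0^'+, derive1 phi e <= c * e `^ k' ;
  phi_hoelder : l < - (1 / 2) -> exists2 a : R, - l - 1 / 2 < a &
    locally_hoelder_pos (fun e => e * derive1 phi e) a
}.

Definition rho (l : R) (phi : R -> R) (r w : R) : R :=
  C_const l * r `^ (2 * l) * g_fun phi (l + 1 / 2) w.

(* J may contain its endpoints: there the equations follow, as one-sided
   derivatives, from continuity and the equations in the interior. *)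
Record solution (l : R) (phi : R -> R) (J : set R) (m w : R -> R) : Prop := {
  sol_interval : is_interval J ;
  sol_nondegenerate : J° !=set0 ;
  sol_radii : forall r, J r -> 0 < r ;
  sol_m_gt0 : forall r, J r -> 0 < m r ;
  sol_w_gt0 : forall r, J r -> 0 < w r ;
  sol_m_continuous : {within J, continuous m} ;
  sol_w_continuous : {within J, continuous w} ;
  sol_m_ode : forall r, J° r ->
    is_derive r 1 m (4 * pi * r ^+ 2 * rho l phi r (w r)) ;
  sol_w_ode : forall r, J° r -> is_derive r 1 w (- (m r / r ^+ 2))
}.

Definition associated_solution (l : R) (phi : R -> R) (J : set R)
    (m w : R -> R) : Prop :=
  solution l phi J m w /\
  forall (J' : set R) (m' w' : R -> R),
    solution l phi J' m' w' -> J `<=` J' ->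
    (forall r, J r -> m' r = m r /\ w' r = w r) ->
    forall r', J' r' -> exists2 r, J r & r' <= r.

Definition solution_radius (J : set R) : \bar R := ereal_sup (EFin @` J).

End vlasov_poisson.

(* Main.v *)
(**
Put a = 3 + 2 l > 1 and write g for g_{l+1/2}.  The bound n <= 3 + l says that
g w / w ^ a is nonincreasing near 0, so g w >= c w ^ a on every interval (0, W].

If the radii were unbounded, integrating dw/dr = - m / r ^ 2 outwards with m
nondecreasing would give w >= m / r, hence dm/dr >= K m ^ a / r, and m would
blow up at a finite value of log r.  So R is finite.

For the mass, phi e <= c e ^ k gives g w <= C w ^ b with b = k + l + 3/2 > - 1,
so m ^ 2 + const * w ^ (b + 1) is nonincreasing on [r1, R) and the monotone
function m is bounded there.

Since [derive1] has a junk value where the derivative does not exist, the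
hypothesis on n is usable only because g is differentiable.  This is shown by
splitting the integral at some d < w: below d the kernel (w - e) ^ (l + 1/2) is
smooth in w; above d the substitution e = d + (w - d) s moves the dependence on
w from the singular kernel into the C^1 function phi.
*)

Require Import Defs.
From HB Require Import structures.
From mathcomp Require Import all_boot all_order all_algebra.
From mathcomp Require Import all_classical all_reals all_analysis.
From mathcomp Require Import measurable_realfun ring lra.

Import Order.TTheory GRing.Theory Num.Theory.
Import numFieldNormedType.Exports.

Local Open Scope classical_set_scope.
Local Open Scope ring_scope.

(** * Derivatives and integrals on the real line *)

Section real_derivatives.
Set Implicit Arguments.
Unset Strict Implicit.
Context {R : realType}.
Implicit Types (f g : R -> R) (x c df dg : R).

(** The usual rules are put in pointwise form, so that the derivative of a composite expression is
    assembled by application and its value adjusted once with [is_derive_eq]. *)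
Lemma is_derive_mulCl c x f df : is_derive x 1 f df ->
  is_derive x 1 (fun y => c * f y) (c * df).
Proof. exact: is_deriveZ. Qed.

Lemma is_derive_mul x f g df dg : is_derive x 1 f df -> is_derive x 1 g dg ->
  is_derive x 1 (fun y => f y * g y) (f x * dg + g x * df).
Proof. exact: is_deriveM. Qed.

Lemma is_derive_add x f g df dg : is_derive x 1 f df -> is_derive x 1 g dg ->
  is_derive x 1 (fun y => f y + g y) (df + dg).
Proof. exact: is_deriveD. Qed.

Lemma is_derive_compose x f g df dg : is_derive x 1 g dg -> is_derive (g x) 1 f df ->
  is_derive x 1 (fun y => f (g y)) (df * dg).
Proof. by move=> dgx dfx; exact: is_derive1_comp dfx dgx. Qed.

Lemma is_derive_powR_comp p x f df : is_derive x 1 f df -> 0 < f x ->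
  is_derive x 1 (fun y => f y `^ p) (p * f x `^ (p - 1) * df).
Proof. by move=> dfx fx0; exact: is_derive1_comp (is_derive1_powR p fx0) dfx. Qed.

Lemma is_derive_const c x : is_derive x 1 (fun=> c : R) 0.
Proof. exact: is_derive_cst. Qed.

Lemma is_derive_var x : is_derive x 1 (fun y : R => y) 1.
Proof. exact: is_derive_id. Qed.

Lemma is_derive_sub c x : is_derive x 1 (fun y : R => y - c) 1.
Proof.
apply: is_derive_eq (is_derive_add (is_derive_var x) (is_derive_const (- c) x)) _.
by rewrite addr0.
Qed.

Lemma is_derive_affine a b c x : is_derive x 1 (fun y : R => a + (y - b) * c) c.
Proof.
apply: is_derive_eq (is_derive_add (is_derive_const a x)
  (is_derive_mul (is_derive_sub b x) (is_derive_const c x))) _.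
by rewrite mulr0 !add0r mulr1.
Qed.

Lemma is_derive_subC c x : is_derive x 1 (fun y : R => c - y) (-1).
Proof.
apply: is_derive_eq (is_derive_add (is_derive_const c x) (is_deriveNid x 1)) _.
by rewrite add0r.
Qed.

Lemma is_derive_continuous x f df : is_derive x 1 f df -> {for x, continuous f}.
Proof. by case=> dfx _; exact/differentiable_continuous/derivable1_diffP. Qed.

End real_derivatives.

(** * Affine substitution and integrability of powers on bounded intervals *)

Section integrals.
Set Implicit Arguments.
Unset Strict Implicit.
Context {R : realType}.
Local Notation mu := lebesgue_measure.

Lemma integrable_itvZl (i : interval R) (c : R) (f : R -> R) :
  mu.-integrable [set` i] (EFin \o f) ->
  mu.-integrable [set` i] (EFin \o (fun x => c * f x)).
Proof.
move=> intf; have := integrableZl _ c intf; rewrite /= => /(_ (measurable_itv i)).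
by apply: eq_integrable => // x _; rewrite /= EFinM.
Qed.

Lemma integrable_itvD (i : interval R) (f g : R -> R) :
  mu.-integrable [set` i] (EFin \o f) -> mu.-integrable [set` i] (EFin \o g) ->
  mu.-integrable [set` i] (EFin \o (fun x => f x + g x)).
Proof.
move=> intf intg; have := integrableD _ intf intg; rewrite /= => /(_ (measurable_itv i)).
by apply: eq_integrable => // x _; rewrite /= EFinD.
Qed.

Lemma integrable_itv_le (i : interval R) (f g : R -> R) :
  measurable_fun [set` i] f -> (forall x, x \in i -> `|f x| <= g x) ->
  mu.-integrable [set` i] (EFin \o g) -> mu.-integrable [set` i] (EFin \o f).
Proof.
move=> mf fg intg; apply: (le_integrable _ _ _ intg) => //.
  exact/measurable_EFinP.
by move=> x /= xi; rewrite lee_fin (le_trans (fg x xi))// ler_norm.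
Qed.

Lemma integrable_itvS (i j : interval R) (f : R -> \bar R) :
  [set` i] `<=` [set` j] -> mu.-integrable [set` j] f -> mu.-integrable [set` i] f.
Proof. by move=> ij; apply: integrableS => //; exact: measurable_itv. Qed.

(** Pushing Lebesgue measure forward along [s |-> b + (d - b) * s] and scaling by [d - b] gives the
    right mass to every half-open interval, hence gives Lebesgue measure back by uniqueness. *)
Lemma ge0_integral_affine (b d : R) (f : R -> \bar R) : b < d ->
  measurable_fun `]b, d[ f -> (forall x, x \in `]b, d[ -> (0 <= f x)%E) ->
  (\int[mu]_(x in `]b, d[) f x =
   (d - b)%:E * \int[mu]_(s in `]0%R, 1%R[) f (b + (d - b) * s)%R)%E.
Proof.
move=> bd mf f0.
have db0 : 0 < d - b by rewrite subr_gt0.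
pose h (s : R) : measurableTypeR R := b + (d - b) * s.
have mh : measurable_fun setT h.
  by apply: measurable_funD => //; apply: measurable_funM.
have hI (x y s : R) : (x < h s <= y) = ((x - b) / (d - b) < s <= (y - b) / (d - b)).
  by rewrite ltr_pdivrMr// ler_pdivlMr// ltrBlDl lerBrDl ![_ * (d - b)]mulrC.
pose k : {nonneg R} := NngNum (ltW db0).
pose nu := mscale k (pushforward mu h).
have muE A : measurable A -> mu A = nu mh A.
  apply: lebesgue_measure_unique => //= _ [[x y]] _ <-.
  rewrite /nu /mscale /= /pushforward.
  have -> : h @^-1` `]x, y] = `](x - b) / (d - b), (y - b) / (d - b)]%classic.
    by apply/seteqP; split => s /=; rewrite !in_itv/= hI.
  rewrite !lebesgue_measure_itv/= !lte_fin ltr_pM2r ?invr_gt0// ltrD2r.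
  case: ifPn => xy; last by rewrite mule0.
  by rewrite -!EFinB -EFinM; congr EFin; field; rewrite gt_eqF.
transitivity (\int[nu mh]_(x in `]b, d[) f x)%E.
  by apply: eq_measure_integral => A mA _; exact: muE.
rewrite ge0_integral_mscale//; congr *%E.
rewrite ge0_integral_pushforward//=; last by move=> y; rewrite inE; exact: f0.
suff -> : h @^-1` `]b, d[ = `]0, 1[%classic by [].
have hd s : (h s < d) = (s < 1).
  by rewrite /h -ltrBrDl -[X in _ < X]mulr1 ltr_pM2l.
by apply/seteqP; split => s /=; rewrite !in_itv/= hd /h ltrDl pmulr_rgt0.
Qed.

(** Monotone convergence along closed segments exhausting the open interval: the bound [C] on all of
    them passes to the limit. This allows [f] to be singular at either endpoint. *)
Lemma integrable_ge0_segment_le (a b : R) (f : R -> R) (C : R) : a < b ->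
  {in `]a, b[, continuous f} -> (forall x, x \in `]a, b[ -> 0 <= f x) ->
  (forall x y, a < x -> x < y -> y < b ->
    (\int[mu]_(t in `[x, y]) (f t)%:E <= C%:E)%E) ->
  mu.-integrable `]a, b[ (EFin \o f).
Proof.
move=> ab cf f0 fC.
have mf : measurable_fun `]a, b[ f.
    apply: open_continuous_measurable_fun => //; exact/in_continuous_mksetP.
have mfE : measurable_fun `]a, b[ (EFin \o f) by exact/measurable_EFinP.
apply/integrableP; split => //.
under eq_integral => x /set_mem xab do rewrite /= ger0_norm ?f0 ?inE//.
pose e (n : nat) : R := (b - a) / 3 / n.+1%:R.
have e0 n : 0 < e n by rewrite !divr_gt0 ?subr_gt0.
have e3 n : e n <= (b - a) / 3.
  by rewrite /e ler_pdivrMr// ler_peMr ?ler1n// divr_ge0// subr_ge0 ltW.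
pose F n := `[a + e n, b - e n]%classic.
have FS n : F n `<=` `]a, b[%classic.
  move=> x; rewrite /F /= !in_itv/= => /andP[ax xb].
  by have := e0 n; lra.
have nF : nondecreasing_seq F.
  move=> n m nm; rewrite subsetEset => x; rewrite /F /= !in_itv/= => /andP[ax xb].
  suff : e m <= e n by lra.
  by rewrite /e ler_wpM2l ?divr_ge0 ?subr_ge0 ?(ltW ab)// lef_pV2 ?posrE// ler_nat.
have UF : \bigcup_n F n = `]a, b[%classic.
  apply/seteqP; split => [x [n _]|x]; first exact: FS.
  rewrite /= in_itv/= => /andP[ax xb].
  have [n] : exists n, e n < Num.min (x - a) (b - x).
    have dab0 : 0 < Num.min (x - a) (b - x) / ((b - a) / 3).
      by rewrite divr_gt0// ?divr_gt0// ?subr_gt0// lt_min !subr_gt0 ax.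
    have [n _ /(_ n (leqnn n))/= nd] := near_infty_natSinv_lt (PosNum dab0).
    exists n; move: nd; rewrite ltr_pdivlMr ?divr_gt0 ?subr_gt0//.
    by rewrite /e mulrC.
  rewrite lt_min => /andP[h1 h2]; exists n => //=; rewrite /F /= in_itv/=; lra.
rewrite -UF.
have cvF : (\int[mu]_(x in F n) (f x)%:E)%E @[n --> \oo] -->
    (\int[mu]_(x in \bigcup_n F n) (f x)%:E)%E.
  apply: ge0_nondecreasing_set_cvg_integral => //.
  - by move=> n; exact: measurable_itv.
  - by move=> n; exact: measurable_funS (measurable_itv _) (@FS n) mfE.
  - by move=> n x Fx; rewrite lee_fin f0//; exact: (FS n).
have <- := cvg_lim _ cvF => //.
apply: (@le_lt_trans _ _ C%:E); last exact: ltry.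
apply: lime_le; first by apply/cvg_ex; eexists; exact: cvF.
near=> n; apply: fC; have := e0 n; have := e3 n; lra.
Unshelve. all: by end_near. Qed.

(** On inner segments the fundamental theorem gives [F y - F x], at most [B + B] whatever the
    segment; nothing is asked of [F] at the endpoints. *)
Lemma integrable_bounded_antiderivative (a b : R) (f F : R -> R) (B : R) : a < b ->
  {in `]a, b[, continuous f} -> (forall x, x \in `]a, b[ -> 0 <= f x) ->
  (forall x, x \in `]a, b[ -> is_derive x 1 F (f x)) ->
  (forall x, x \in `]a, b[ -> `|F x| <= B) ->
  mu.-integrable `]a, b[ (EFin \o f).
Proof.
move=> ab cf f0 dF FB; apply: (@integrable_ge0_segment_le _ _ _ (B + B)) => // x y ax xy yb.
have sub t : t \in `[x, y] -> t \in `]a, b[ by rewrite !in_itv/= => /andP[? ?]; lra.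
have cF t : t \in `]a, b[ -> {for t, continuous F}.
  by move=> /dF; exact: is_derive_continuous.
rewrite (@continuous_FTC2 _ f F)//.
- rewrite lee_fin; apply: (le_trans (ler_norm _)); apply: (le_trans (ler_normB _ _)).
  by apply: lerD; apply: FB; apply: sub; rewrite in_itv/= lexx ltW.
- by apply: continuous_in_subspaceT => t; rewrite inE => /sub; exact: cf.
- split; first by move=> t tI; have [] := dF t (sub t (subset_itv_oo_cc tI)).
  + by apply: cvg_at_right_filter; apply: cF; apply: sub; rewrite in_itv/= lexx ltW.
  + by apply: cvg_at_left_filter; apply: cF; apply: sub; rewrite in_itv/= lexx ltW.
- by move=> t tI; have [_] := dF t (sub t (subset_itv_oo_cc tI)); rewrite derive1E.
Qed.

Lemma continuous_powR (p x : R) : 0 < x -> {for x, continuous (@powR R ^~ p)}.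
Proof. by move=> x0; exact: is_derive_continuous (is_derive1_powR p x0). Qed.

Lemma powR_le1 (p x : R) : 0 <= p -> 0 <= x -> x <= 1 -> x `^ p <= 1.
Proof.
move=> p0 x0 x1; have <- : 1 `^ p = 1 :> R by rewrite powR1.
by rewrite ge0_ler_powR// nnegrE.
Qed.

Lemma integrable_powR01 (p : R) : -1 < p ->
  mu.-integrable `]0, 1[ (EFin \o (fun s : R => s `^ p)).
Proof.
move=> p1; have p10 : 0 < p + 1 by lra.
apply: (@integrable_bounded_antiderivative _ _ _ (fun x => (p + 1)^-1 * x `^ (p + 1)) (p + 1)^-1) => //.
- by move=> x; rewrite in_itv/= => /andP[x0 _]; exact: continuous_powR.
- by move=> x _; exact: powR_ge0.
- move=> x; rewrite in_itv/= => /andP[x0 _].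
  apply: is_derive_eq; first exact: is_derive_mulCl (is_derive1_powR (p + 1) x0).
  by rewrite addrK mulrA mulVf ?mul1r// gt_eqF.
- move=> x; rewrite in_itv/= => /andP[x0 x1].
  rewrite ger0_norm ?mulr_ge0 ?powR_ge0 ?invr_ge0 ?(ltW p10)//.
  rewrite ler_piMr ?invr_ge0 ?(ltW p10)// powR_le1//; lra.
Qed.

Lemma integrable_onem_powR01 (p : R) : -1 < p ->
  mu.-integrable `]0, 1[ (EFin \o (fun s : R => (1 - s) `^ p)).
Proof.
move=> p1; have p10 : 0 < p + 1 by lra.
apply: (@integrable_bounded_antiderivative _ _ _
  (fun x => - (p + 1)^-1 * (1 - x) `^ (p + 1)) (p + 1)^-1) => //.
- move=> x; rewrite in_itv/= => /andP[_ x1].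
  have x10 : 0 < 1 - x by rewrite subr_gt0.
  exact: is_derive_continuous (is_derive_powR_comp p (is_derive_subC 1 x) x10).
- by move=> x _; exact: powR_ge0.
- move=> x; rewrite in_itv/= => /andP[_ x1].
  have x10 : 0 < 1 - x by rewrite subr_gt0.
  apply: is_derive_eq; first exact: is_derive_mulCl
    (is_derive_powR_comp _ (is_derive_subC 1 x) x10).
  by rewrite addrK mulrN1 mulrNN mulrA mulVf ?mul1r// gt_eqF.
- move=> x; rewrite in_itv/= => /andP[x0 x1].
  rewrite mulNr normrN ger0_norm ?mulr_ge0 ?powR_ge0 ?invr_ge0 ?(ltW p10)//.
  rewrite ler_piMr ?invr_ge0 ?(ltW p10)// powR_le1//; lra.
Qed.

(** A power is monotone, in a direction depending on the sign of [q]. The sum of both endpoint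
    values serves as a bound that needs no case distinction later. *)
Lemma powR_le_endpoints (q x0 x1 x : R) : 0 < x0 -> x0 <= x -> x <= x1 ->
  x `^ q <= x0 `^ q + x1 `^ q.
Proof.
move=> x00 x0x xx1; have xgt0 : 0 < x by exact: lt_le_trans x0x.
have [q0|q0] := leP 0 q.
  by rewrite -[leLHS]add0r lerD ?powR_ge0// ge0_ler_powR// nnegrE; lra.
rewrite -[leLHS]addr0 lerD ?powR_ge0// -(opprK q) !(powRN _ (- q)).
rewrite lef_pV2 ?posrE ?powR_gt0// ge0_ler_powR// ?nnegrE ?oppr_ge0 ltW//.
Qed.

(** Each half of the interval contains only one singularity: [A] bounds the factor in [1 - s] up to
    1/2, and [B] bounds the factor in [s] from 1/2 on. *)
Lemma integrable_beta (k p : R) : -1 < k -> -1 < p ->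
  mu.-integrable `]0, 1[ (EFin \o (fun s : R => s `^ k * (1 - s) `^ p)).
Proof.
move=> k1 p1.
pose A := 2^-1 `^ p + 1 `^ p : R; pose B := 2^-1 `^ k + 1 `^ k : R.
have A0 : 0 <= A by rewrite addr_ge0 ?powR_ge0.
have B0 : 0 <= B by rewrite addr_ge0 ?powR_ge0.
apply: (@integrable_itv_le _ _ (fun s : R => A * s `^ k + B * (1 - s) `^ p)).
- apply: measurable_funM; first exact: measurable_funS (measurable_powR k).
  by apply: (measurableT_comp (measurable_powR p)); apply: measurable_funB.
- move=> s; rewrite in_itv/= => /andP[s0 s1].
  rewrite ger0_norm ?mulr_ge0 ?powR_ge0//.
  have [s2|s2] := leP s 2^-1.
    rewrite -[leLHS]addr0 lerD ?mulr_ge0 ?powR_ge0// mulrC ler_wpM2r ?powR_ge0//.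
    by apply: powR_le_endpoints; lra.
  rewrite -[leLHS]add0r lerD ?mulr_ge0 ?powR_ge0// ler_wpM2r ?powR_ge0//.
  by apply: powR_le_endpoints; lra.
- apply: integrable_itvD; apply: integrable_itvZl.
    exact: integrable_powR01.
  exact: integrable_onem_powR01.
Qed.

End integrals.

(** * The functions g *)

Section g_fun_estimates.
Set Implicit Arguments.
Unset Strict Implicit.
Context {R : realType}.
Local Notation mu := lebesgue_measure.

(** For nonnegative functions the substitution holds in the extended reals, so finiteness on the
    unit interval carries over to []b, d[] and the identity descends to real integrals. *)
Lemma Rintegral_affine (b d : R) (f : R -> R) : b < d ->
  measurable_fun `]b, d[ f -> (forall x, x \in `]b, d[ -> 0 <= f x) ->
  mu.-integrable `]0, 1[ (EFin \o (fun s => f (b + (d - b) * s))) ->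
  mu.-integrable `]b, d[ (EFin \o f) /\
  \int[mu]_(x in `]b, d[) f x = (d - b) * \int[mu]_(s in `]0, 1[) f (b + (d - b) * s).
Proof.
move=> bd mf f0 intf.
have mfE : measurable_fun `]b, d[ (EFin \o f) by exact/measurable_EFinP.
have E : (\int[mu]_(x in `]b, d[) (f x)%:E =
    (d - b)%:E * \int[mu]_(s in `]0%R, 1%R[) (f (b + (d - b) * s)%R)%:E)%E.
  by apply: ge0_integral_affine => // x xbd; rewrite lee_fin f0.
have fin01 : (\int[mu]_(s in `]0%R, 1%R[) (f (b + (d - b) * s)%R)%:E)%E \is a fin_num.
  exact: integrable_fin_num intf.
split; last by rewrite /Rintegral E fineM.
apply/integrableP; split => //.
under eq_integral => x /set_mem xab do rewrite /= ger0_norm ?f0 ?inE//.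
by rewrite E ltey_eq fin_numM.
Qed.

Lemma measurable_affine (b d : R) (f : R -> R) : b < d ->
  measurable_fun `]b, d[ f -> measurable_fun `](0 : R), 1[ (fun s : R => f (b + (d - b) * s)).
Proof.
move=> bd mf; apply: (@measurable_comp _ _ _ _ _ _ `]b, d[%classic) => //.
  move=> _ [s /= + <-]; rewrite !in_itv/= => /andP[s0 s1].
  by apply/andP; split; nra.
by apply: measurable_funD => //; apply: measurable_funM.
Qed.

Context (l : R) (phi : R -> R) (hphi : regular_phi l phi).

Lemma phi_continuous (e : R) : 0 < e -> {for e, continuous phi}.
Proof.
by move=> /(phi_derivable hphi) d; exact/differentiable_continuous/derivable1_diffP.
Qed.

(** The assumed bound near 0 handles [e < x0]. On the compact rest [phi] is bounded and [e ^ k]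
    stays away from 0, so enlarging the constant is enough and [k] is the same for all [W]. *)
Lemma phi_le_powR : exists2 k : R, -1 < k & forall W : R, 0 < W ->
  exists2 c : R, 0 <= c & forall e, 0 < e -> e <= W -> phi e <= c * e `^ k.
Proof.
have [k [c0 [k1 [eps /= eps0 near0]]]] := phi_near0 hphi.
exists k => // W W0.
pose x0 : R := eps / 2; have x00 : 0 < x0 by rewrite divr_gt0.
have [M [_ HM]] : [bounded phi e | e in `[x0, W]].
  apply: (phi_bounded hphi); first exact: segment_compact.
  by move=> x; rewrite /= !in_itv/= andbT => /andP[? _]; exact: lt_le_trans x00 _.
pose M1 := `|M| + 1; pose D := x0 `^ (- k) + W `^ (- k).
have M10 : 0 <= M1 by rewrite addr_ge0.
have D0 : 0 <= D by rewrite addr_ge0 ?powR_ge0.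
exists (`|c0| + M1 * D); first by rewrite addr_ge0 ?mulr_ge0.
move=> e e0 eW; rewrite mulrDl.
have [ex|xe] := ltP e x0.
  rewrite -[leLHS]addr0 lerD//; last by rewrite !mulr_ge0 ?powR_ge0.
  apply: (@le_trans _ _ (c0 * e `^ k)); last by rewrite ler_wpM2r ?powR_ge0 ?ler_norm.
  apply: near0 => //=; rewrite sub0r normrN gtr0_norm//.
  by apply: lt_trans ex _; rewrite /x0 ltr_pdivrMr// ltr_pMr// ltr1n.
rewrite -[leLHS]add0r lerD//; first by rewrite mulr_ge0 ?powR_ge0.
have phiM : phi e <= M1.
  apply: (le_trans (ler_norm _)); apply: HM => /=; last by rewrite in_itv/= xe.
  by rewrite /M1 (le_lt_trans (ler_norm _))// ltrDl.
apply: (le_trans phiM); rewrite -mulrA ler_peMr//.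
have <- : e `^ (- k) * e `^ k = 1 by rewrite powRN mulVf// gt_eqF// powR_gt0.
by rewrite ler_wpM2r ?powR_ge0//; exact: powR_le_endpoints.
Qed.

Lemma measurable_g_integrand (p b w : R) : 0 <= b ->
  measurable_fun `]b, w[ (fun e => phi e * (w - e) `^ p).
Proof.
move=> b0; apply: measurable_funM.
  apply: open_continuous_measurable_fun => //; apply/in_continuous_mksetP => x.
  by rewrite in_itv/= => /andP[bx _]; apply: phi_continuous; exact: le_lt_trans bx.
by apply: (measurableT_comp (measurable_powR p)); apply: measurable_funB.
Qed.

(** With [e = w * s] the bound on [phi] factors out [w ^ (k + p + 1)] and leaves a Beta integral
    independent of [w], which is absorbed into the constant. *)
Lemma g_fun_le (p : R) : -1 < p -> exists2 k : R, -1 < k &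
  forall W : R, 0 < W -> exists2 c : R, 0 <= c &
  forall w, 0 < w -> w <= W ->
    mu.-integrable `]0, w[ (EFin \o (fun e => phi e * (w - e) `^ p)) /\
    g_fun phi p w <= c * w `^ (k + p + 1).
Proof.
move=> p1; have [k k1 H] := phi_le_powR; exists k => // W W0.
have [c c0 phic] := H W W0.
pose be := fun s : R => s `^ k * (1 - s) `^ p.
have be0 s : 0 <= be s by rewrite mulr_ge0 ?powR_ge0.
exists (c * \int[mu]_(s in `]0, 1[) be s).
  by rewrite mulr_ge0// Rintegral_ge0.
move=> w w0 wW; pose f e := phi e * (w - e) `^ p.
have f0 x : x \in `]0, w[ -> 0 <= f x.
  by rewrite in_itv/= => /andP[x0 _]; rewrite mulr_ge0 ?powR_ge0// (phi_ge0 hphi).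
have mf : measurable_fun `]0, w[ f by exact: measurable_g_integrand.
have fbe s : s \in `]0, 1[ -> f (0 + (w - 0) * s) <= c * (w `^ k * w `^ p) * be s.
  rewrite in_itv/= => /andP[s0 s1]; rewrite add0r subr0 /f /be.
  have -> : w - w * s = w * (1 - s) by ring.
  rewrite powRM ?subr_ge0 ?(ltW w0) ?(ltW s1)//.
  have : phi (w * s) <= c * (w `^ k * s `^ k).
    rewrite -powRM ?(ltW w0) ?(ltW s0)//; apply: phic; first by rewrite mulr_gt0.
    by rewrite (le_trans _ wW)// ler_piMr// ltW.
  move=> /(ler_wpM2r (mulr_ge0 (powR_ge0 w p) (powR_ge0 (1 - s) p))).
  by move=> /le_trans; apply; rewrite le_eqVlt; apply/orP; left; apply/eqP; ring.
have intbe : mu.-integrable `]0, 1[ (EFin \o (fun s => c * (w `^ k * w `^ p) * be s)).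
  by apply: integrable_itvZl; exact: integrable_beta.
have intf : mu.-integrable `]0, 1[ (EFin \o (fun s => f (0 + (w - 0) * s))).
  apply: integrable_itv_le intbe; last first.
    move=> s s01; rewrite ger0_norm ?fbe// f0// in_itv/= add0r subr0.
    move: s01; rewrite in_itv/= => /andP[s0 s1].
    by rewrite mulr_gt0//= -[ltRHS]mulr1 ltr_pM2l.
  exact: measurable_affine.
have [intfw E] := Rintegral_affine w0 mf f0 intf; split => //.
rewrite /g_fun E subr0.
have -> : c * \int[mu]_(s in `]0, 1[) be s * w `^ (k + p + 1) =
    w * \int[mu]_(s in `]0, 1[) (c * (w `^ k * w `^ p) * be s).
  rewrite RintegralZl//; last exact: integrable_beta.
  have w0' : w != 0 by rewrite gt_eqF.
  rewrite !powRD ?w0' ?implybT// powRr1 ?ltW//; ring.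
rewrite ler_wpM2l ?(ltW w0)//; apply: le_Rintegral => //.
  by move: intf; rewrite subr0.
by move=> s /= s01; move: (fbe s s01); rewrite subr0.
Qed.

Lemma g_fun_derivable (p w : R) : -1 < p -> 0 < w -> derivable (g_fun phi p) w 1.
Proof.
move=> p1 w0; have [k k1 gle] := g_fun_le p1.
(* The cut [d] lies strictly below the neighbourhood []u, v[] of [w], so [x - d] stays away from 0
   for all [x] in it. *)
pose d := w / 4; pose u := w / 2; pose v := 2 * w.
have v0 : 0 < v by rewrite /v; lra.
have [C C0 gC] := gle v v0.
have d0 : 0 < d by rewrite /d; lra.
have du : d < u by rewrite /d /u; lra.
have uw : u < w by rewrite /u; lra.
have wv : w < v by rewrite /v; lra.
have Iw : `]u, v[%classic w by rewrite /= in_itv/= uw.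
have dphi (e : R) : 0 < e -> is_derive e 1 phi (derive1 phi e).
  by move=> e0; apply: DeriveDef; [exact: phi_derivable hphi _ _ | rewrite derive1E].
have sub : `[d, v] `<=` `]0, +oo[%classic.
  by move=> x; rewrite /= !in_itv/= andbT => /andP[? _]; exact: lt_le_trans d0 _.
have [M0 [_ HM0]] := phi_bounded hphi (@segment_compact _ _ _) sub.
have [M1 [_ HM1]] := dphi_bounded hphi (@segment_compact _ _ _) sub.
pose M := `|M0| + `|M1| + 1.
have M_ge0 : 0 <= M by rewrite !addr_ge0.
have phiM (e : R) : d <= e -> e <= v -> `|phi e| <= M.
  move=> de ev; apply: HM0; last by rewrite /= in_itv/= de.
  by rewrite /M (le_lt_trans (ler_norm _))// -addrA ltrDl ltr_wpDl.
have dphiM (e : R) : d <= e -> e <= v -> `|derive1 phi e| <= M.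
  move=> de ev; apply: HM1; last by rewrite /= in_itv/= de.
  by rewrite /M (le_lt_trans (ler_norm _))// addrAC addrC ltrDl ltr_wpDl.
pose f (x e : R) := phi e * (x - e) `^ p.
(* [A] is the part below the cut. [H] is the rescaled part above it, where [x] occurs only inside
   [phi]; the two are recombined as [A x + (x - d) ^ (p + 1) * H x]. *)
pose A (x : R) := \int[mu]_(e in `]0, d]) f x e.
pose h (x s : R) := phi (d + (x - d) * s) * (1 - s) `^ p.
pose H (x : R) := \int[mu]_(s in `]0, 1[) h x s.
have xuv (x : R) : `]u, v[%classic x -> [/\ u < x, x < v & d < x].
  by rewrite /= in_itv/= => /andP[? ?]; split => //; exact: lt_trans du _.
have arg (x s : R) : `]u, v[%classic x -> s \in `]0, 1[ ->
    [/\ d < d + (x - d) * s, d + (x - d) * s < v & 0 < d + (x - d) * s].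
  by move=> /xuv[ux xv dx]; rewrite in_itv/= => /andP[s0 s1]; split; nra.
have mh (x : R) : `]u, v[%classic x -> measurable_fun `](0 : R), 1[ (h x).
  move=> /xuv[ux xv dx]; apply: measurable_funM.
    apply: measurable_affine => //; apply: open_continuous_measurable_fun => //.
    apply/in_continuous_mksetP => y; rewrite in_itv/= => /andP[dy _].
    by apply: phi_continuous; exact: lt_trans dy.
  by apply: (measurableT_comp (measurable_powR p)); apply: measurable_funB.
have intM : mu.-integrable `]0, 1[ (EFin \o (fun s : R => M * (1 - s) `^ p)).
  by apply: integrable_itvZl; exact: integrable_onem_powR01.
have inth (x : R) : `]u, v[%classic x -> mu.-integrable `]0, 1[ (EFin \o h x).
  move=> Ix; apply: integrable_itv_le intM; first exact: mh.
  move=> s s01; have [h1 h2 _] := arg x s Ix s01.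
  by rewrite normrM [in X in _ * X]ger0_norm ?powR_ge0// ler_wpM2r ?powR_ge0// phiM// ltW.
have dh (x s : R) : `]u, v[%classic x -> s \in `]0, 1[ ->
    is_derive x 1 (h ^~ s) (derive1 phi (d + (x - d) * s) * s * (1 - s) `^ p).
  move=> Ix s01; have [_ _ h3] := arg x s Ix s01.
  have D := is_derive_compose (is_derive_affine d d s x) (dphi _ h3).
  apply: is_derive_eq (is_derive_mul D (is_derive_const ((1 - s) `^ p) x)) _.
  by rewrite mulr0 add0r mulrC.
(* The arguments of [phi] and of its derivative stay in [[d, v]], so [M * (1 - s) ^ p] dominates the
   derivative in [x] uniformly over []u, v[]. *)
have dH : derivable H w 1.
  apply: (@derivable_under_integral _ _ _ mu h _ _ w u v _ _ _ (fun s : R => M * (1 - s) `^ p)).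
  - exact: measurable_itv.
  - exact: Iw.
  - exact: inth.
  - by move=> x s Ix s01; have [] := dh x s Ix s01.
  - by move=> s; rewrite mulr_ge0 ?powR_ge0.
  - exact: intM.
  - move=> x s Ix s01; rewrite partial1of2E; have [_ ->] := dh x s Ix s01.
    have [h1 h2 _] := arg x s Ix s01.
    rewrite normrM [in X in _ * X]ger0_norm ?powR_ge0// ler_wpM2r ?powR_ge0//.
    move: s01; rewrite /= in_itv/= => /andP[s0 s1].
    by rewrite normrM (gtr0_norm s0) -[leRHS]mulr1 ler_pM// ?dphiM ?(ltW s0) ?(ltW s1)
      ?(ltW h1) ?(ltW h2).
have dA : derivable A w 1.
  have dfx (x e : R) : `]u, v[%classic x -> `]0, d]%classic e ->
      is_derive x 1 (f ^~ e) (phi e * (p * (x - e) `^ (p - 1))).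
    move=> /xuv[ux xv dx]; rewrite /= in_itv/= => /andP[e0 ed].
    have xe0 : 0 < x - e by rewrite subr_gt0; exact: le_lt_trans dx.
    have D := is_derive_mulCl (phi e) (is_derive_powR_comp p (is_derive_sub e x) xe0).
    apply: is_derive_eq D _.
    by rewrite mulr1.
  (* For [e] in []0, d]] and [x] in []u, v[], the difference [x - e] lies between [u - d > 0] and
     [v]; [K] therefore bounds the derivative of the kernel. *)
  pose K : R := `|p| * ((u - d) `^ (p - 1) + v `^ (p - 1)).
  have sub0 (x : R) : d < x -> `]0, d] `<=` `]0, x[%classic.
    by move=> dx y; rewrite /= !in_itv/= => /andP[-> yd]; exact: le_lt_trans dx.
  have intphi : mu.-integrable `]0, d] (EFin \o (fun e => K * `|phi e|)).
    apply: integrable_itvZl.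
    (* With exponent 0 the kernel is identically 1, so the integrability part of [g_fun_le] becomes
       integrability of [phi] itself near 0. *)
    have [k0 k01 g0le] := @g_fun_le 0 (ltrN10 _).
    have [C1 _ /(_ v v0 (lexx v))[int0 _]] := g0le v v0.
    have dv : d < v by exact: lt_trans (lt_trans du uw) wv.
    apply: (@integrable_itv_le _ _ _ (fun e => phi e * (v - e) `^ 0)); last 1 first.
    - exact: integrable_itvS (sub0 v dv) int0.
    - apply: measurableT_comp => //; apply: measurable_funS (sub0 v dv) _ => //.
      apply: open_continuous_measurable_fun => //; apply/in_continuous_mksetP => y.
      by rewrite in_itv/= => /andP[y0 _]; exact: phi_continuous.
    - move=> e; rewrite in_itv/= => /andP[e0 ed].
      by rewrite powRr0 mulr1 normr_id ger0_norm// (phi_ge0 hphi).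
  apply: (@derivable_under_integral _ _ _ mu f _ _ w u v _ _ _ (fun e => K * `|phi e|)).
  - exact: measurable_itv.
  - exact: Iw.
  - move=> x /xuv[ux xv dx]; have [intx _] := gC x (lt_trans d0 dx) (ltW xv).
    exact: integrable_itvS (sub0 x dx) intx.
  - by move=> x e Ix ed; have [] := dfx x e Ix ed.
  - by move=> e; rewrite !mulr_ge0 ?addr_ge0 ?powR_ge0.
  - exact: intphi.
  - move=> x e Ix ed; rewrite partial1of2E; have [_ ->] := dfx x e Ix ed.
    rewrite normrM mulrC ler_wpM2r// normrM ler_wpM2l// ger0_norm ?powR_ge0//.
    have [ux xv dx] := xuv x Ix; move: ed; rewrite /= in_itv/= => /andP[e0 ed].
    clear -e0 ed ux xv d0 du; apply: powR_le_endpoints; lra.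
have E (x : R) : `]u, v[%classic x -> g_fun phi p x = A x + (x - d) `^ (p + 1) * H x.
  move=> Ix; have [ux xv dx] := xuv x Ix.
  have [intx _] := gC x (lt_trans d0 dx) (ltW xv).
  (* [A] integrates up to and including [d], so what remains of []0, x[] is exactly the open
     interval []d, x[] required by the substitution. *)
  have Ed := Rintegral_itvB intx (_ : (BRight 0 <= BRight d)%O) (_ : (BRight d <= BLeft x)%O).
  rewrite /g_fun -[LHS](subrK (A x)) addrC Ed ?bnd_simp ?ltW//; congr (_ + _).
  have fh s : s \in `]0, 1[ -> f x (d + (x - d) * s) = (x - d) `^ p * h x s.
    rewrite in_itv/= => /andP[s0 s1]; rewrite /f /h.
    have -> : x - (d + (x - d) * s) = (x - d) * (1 - s) by ring.
    by rewrite powRM ?subr_ge0 ?(ltW dx) ?(ltW s1)//; ring.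
  have [|||_ ->] := @Rintegral_affine d x (f x) dx.
  - by apply: measurable_g_integrand; exact: ltW.
  - move=> y; rewrite in_itv/= => /andP[dy _].
    by rewrite mulr_ge0 ?powR_ge0// (phi_ge0 hphi)// (lt_trans d0 dy).
  - have := integrable_itvZl ((x - d) `^ p) (inth x Ix).
    by apply: eq_integrable => // s /set_mem s01; rewrite /= fh.
  under eq_Rintegral => s /set_mem s01 do rewrite fh//.
  rewrite RintegralZl//; last exact: inth.
  by rewrite powRD ?powRr1 ?subr_ge0 ?(ltW dx)// ?subr_eq0 ?(gt_eqF dx) ?implybT// /H; ring.
apply: (@near_eq_derivable _ _ _ (fun x => A x + (x - d) `^ (p + 1) * H x)).
  near=> x; apply/esym/E; near: x; exact: near_in_itvoo.
have wd0 : 0 < w - d by rewrite subr_gt0; exact: lt_trans uw.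
have dP := is_derive_powR_comp (p + 1) (is_derive_sub d w) wd0.
by have [] := is_derive_add (derivableP dA) (is_derive_mul dP (derivableP dH)).
Unshelve. all: by end_near.
Qed.

End g_fun_estimates.

(** * Positivity of the Gamma function and of the constant [C_const] *)

Section gamma.
Set Implicit Arguments.
Unset Strict Implicit.
Context {R : realType}.
Local Notation mu := lebesgue_measure.

(** Sublinearity of the logarithm at [t / (2 * q)] gives [q * ln t <= t / 2 + q * ln (2 * q)]; half
    of the exponential decay absorbs the power. *)
Lemma powR_expR_le (q : R) : 0 < q ->
  exists2 C : R, 0 <= C & forall t, 0 < t -> t `^ q * expR (- t) <= C * expR (- (2^-1 * t)).
Proof.
move=> q0; exists ((2 * q) `^ q); first exact: powR_ge0.
move=> t t0; rewrite /powR !gt_eqF ?mulr_gt0// -!expRD ler_expR.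
have q20 : 0 < 2 * q by rewrite mulr_gt0.
have -> : ln t = ln (t / (2 * q)) + ln (2 * q).
  by rewrite -lnM ?posrE ?divr_gt0// divfK// gt_eqF.
have /ltW := ln_sublinear (divr_gt0 t0 q20).
move=> /(ler_wpM2l (ltW q0)).
have -> : q * (t / (2 * q)) = 2^-1 * t by field; rewrite gt_eqF.
rewrite mulrDr; set a := q * ln (t / _); set b := q * ln _; lra.
Qed.

(** The real integral is [fine] of an extended one, and [fine] sends an infinite value to 0.
    Positivity thus requires finiteness as well as a positive lower bound. *)
Lemma gamma_fun_gt0 (s : R) : 0 < s -> 0 < gamma_fun s.
Proof.
move=> s0; rewrite /gamma_fun /Rintegral; apply: fine_gt0.
pose f (t : R) := t `^ (s - 1) * expR (- t).
have f0 t : 0 <= f t by rewrite mulr_ge0 ?powR_ge0 ?expR_ge0.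
have mf : measurable_fun setT (EFin \o f).
  apply/measurable_EFinP; apply: measurable_funM; first exact: measurable_powR.
  by apply: measurableT_comp => //; exact: measurable_funN.
have s1 : -1 < s - 1 by lra.
apply/andP; split.
  (* On [[1, 2]] the power is at least the smaller of its endpoint values and the exponential at
     least [expR (-2)]. *)
  pose c : R := Num.min 1 (2 `^ (s - 1)) * expR (-2).
  have c0 : 0 < c by rewrite mulr_gt0 ?expR_gt0// lt_min ltr01 powR_gt0.
  have sub : `[1, 2] `<=` `](0 : R), +oo[%classic.
    by move=> x; rewrite /= !in_itv/= andbT => /andP[? _]; exact: lt_le_trans ltr01 _.
  apply: (@lt_le_trans _ _ (\int[mu]_(t in `[1%R, 2%R]) c%:E)%E).
    rewrite integral_cst//= lebesgue_measure_itv/= lte_fin ltr1n.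
    by rewrite -EFinB -EFinM lte_fin mulr_gt0//; lra.
  apply: (@le_trans _ _ (\int[mu]_(t in `[1%R, 2%R]) (f t)%:E)%E).
    apply: ge0_le_integral => //.
    - by move=> x _; rewrite lee_fin ltW.
    - exact: measurable_funS mf.
    - move=> x; rewrite /= in_itv/= => /andP[x1 x2]; rewrite lee_fin.
      apply: ler_pM; rewrite ?expR_ge0 ?ler_expR ?lerN2//.
      rewrite ge_min; have [s10|s10] := leP 0 (s - 1).
        by rewrite -[leLHS](powRr0 x) ler_powR.
      apply/orP; right; rewrite -(opprK (s - 1)) !(powRN _ (- (s - 1))).
      have xgt0 : 0 < x by exact: lt_le_trans x1.
      by rewrite lef_pV2 ?posrE ?powR_gt0// ge0_ler_powR// ?nnegrE ?oppr_ge0 ltW.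
  apply: ge0_subset_integral => //; first exact: measurable_funS mf.
  by move=> x _; rewrite lee_fin; exact: f0.
have -> : `](0 : R), +oo[%classic = `]0, 1[ `|` `[1, +oo[.
  apply/seteqP; split => x /=; rewrite !in_itv/= !andbT.
    by move=> x0; case: (ltP x 1) => x1; [left; rewrite x0|right].
  by case=> [/andP[]//|]; exact: lt_le_trans.
rewrite ge0_integral_setU//=; last 3 first.
- exact: measurable_funS mf.
- by move=> x _; rewrite lee_fin; exact: f0.
- rewrite disj_set2E; apply/eqP/seteqP; split => // x [] /=.
  rewrite !in_itv/= andbT => /andP[_ x1]; rewrite leNgt => /negP; exact.
apply: lte_add_pinfty.
  have /integrableP[_] : mu.-integrable `]0, 1[ (EFin \o f).
    apply: integrable_itv_le (integrable_powR01 s1).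
      by apply/measurable_EFinP; exact: measurable_funS mf.
    move=> x; rewrite in_itv/= => /andP[x0 x1]; rewrite ger0_norm//.
    by rewrite /f ler_piMr ?powR_ge0// -expR0 ler_expR oppr_le0 ltW.
  by under eq_integral do rewrite /= ger0_norm//.
(* For [t >= 1] the larger, positive exponent only increases the power. The majorant
   [C * expR (- (t / 2))] is [2 * C] times the exponential density of rate 1/2. *)
have q0 : 0 < `|s - 1| + 1 by rewrite ltr_wpDl.
have [C C0 HC] := powR_expR_le q0.
have h2 : 0 < 2^-1 :> R by rewrite invr_gt0.
have intC : mu.-integrable `[1, +oo[ (EFin \o (fun t => 2 * C * exponential_pdf 2^-1 t)).
  apply: integrable_itvZl; apply: integrableS (integrable_exponential_pdf h2) => //.
have /integrableP[_] : mu.-integrable `[1, +oo[ (EFin \o f).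
  apply: (@integrable_itv_le _ _ _ (fun t => 2 * C * exponential_pdf 2^-1 t)).
  - by apply/measurable_EFinP; exact: measurable_funS mf.
  - move=> t; rewrite in_itv/= andbT => t1; have t0 : 0 < t by exact: lt_le_trans t1.
    rewrite exponential_pdfE ?(ltW t0)// ger0_norm//.
    have -> : 2 * C * (2^-1 * expR (- 2^-1 * t)) = C * expR (- (2^-1 * t)).
      by rewrite mulNr; field.
    apply: le_trans (HC _ t0); rewrite ler_wpM2r ?expR_ge0// ler_powR//.
    by rewrite (le_trans (ler_norm _))// lerDl.
  - exact: intC.
by under eq_integral do rewrite /= ger0_norm//.
Qed.

Lemma C_const_gt0 (l : R) : -1 < l -> 0 < C_const l.
Proof.
move=> l1; rewrite /C_const divr_gt0 ?mulr_gt0 ?powR_gt0 ?pi_gt0 ?gamma_fun_gt0//; lra.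
Qed.

End gamma.

(** * From the bound on the polytropic index to a power lower bound on g *)

Section lower_bound.
Set Implicit Arguments.
Unset Strict Implicit.
Context {R : realType}.

(** In the variable [t = ln w] the function [h t = ln (g (expR t)) - a * t] is nonincreasing up to
    [ln w0]. The constant is [g w0 / w0 ^ a], so equality holds at [w0]. *)
Lemma log_derivative_le_powR (g : R -> R) (a w0 : R) : 0 < w0 ->
  (forall w, 0 < w -> 0 < g w) -> (forall w, 0 < w -> derivable g w 1) ->
  (forall w, 0 < w -> w <= w0 -> derive1 (fun t => ln (g (expR t))) (ln w) <= a) ->
  exists2 c, 0 < c & forall w, 0 < w -> w <= w0 -> c * w `^ a <= g w.
Proof.
move=> w00 g0 dg ga.
pose G (t : R) := ln (g (expR t)).
pose h (t : R) := G t + - a * t.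
have dG (t : R) : is_derive t 1 G (derive1 G t).
  rewrite derive1E; apply: derivableP.
  by have [] := is_derive_compose
    (is_derive_compose (is_derive_expR t) (derivableP (dg _ (expR_gt0 t))))
    (is_derive1_ln (g0 _ (expR_gt0 t))).
have dh (t : R) : is_derive t 1 h (derive1 G t - a).
  apply: is_derive_eq (is_derive_add (dG t) (is_derive_mulCl (- a) (is_derive_var t))) _.
  by rewrite mulr1.
exists (expR (h (ln w0))); first exact: expR_gt0.
move=> w wgt0 ww0; rewrite -[leRHS]lnK ?posrE ?g0// /powR gt_eqF// -expRD ler_expR.
have lnww0 : ln w <= ln w0 by rewrite ler_ln ?posrE.
suff : h (ln w0) <= h (ln w).
  by rewrite {2}/h /G lnK ?posrE//; lra.
apply: (@ler0_derive1_nincrNy _ h (ln w0)) => //.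
- move=> t; rewrite in_itv/= => tw0.
  rewrite derive1E; have [_ ->] := dh t; rewrite subr_le0 -[t]expRK.
  by apply: ga; rewrite ?expR_gt0// -ler_ln ?posrE ?expR_gt0// expRK ltW.
- by apply: continuous_subspaceT => t; exact: is_derive_continuous (dh t).
Qed.

(** Near 0 the index bound says that the logarithmic derivative is at most [3 + 2 * l]. Between [w0]
    and [W] continuity gives g a positive minimum, which suffices after shrinking the constant. *)
Lemma g_fun_ge (l : R) (phi : R -> R) : -1 < l -> regular_phi l phi ->
  (forall w, 0 < w -> 0 < g_fun phi (l + 1 / 2) w) ->
  (exists2 w0 : R, 0 < w0 &
     forall w : R, 0 < w -> w <= w0 -> polytropic_index l phi w <= 3 + l) ->
  forall W, 0 < W -> exists2 c, 0 < c & forall w, 0 < w -> w <= W ->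
    c * w `^ (3 + 2 * l) <= g_fun phi (l + 1 / 2) w.
Proof.
move=> l1 hphi g0 [w0 w00 hn] W W0.
have p1 : -1 < l + 1 / 2 by lra.
have dg (w : R) : 0 < w -> derivable (g_fun phi (l + 1 / 2)) w 1 := g_fun_derivable hphi p1.
have ga w : 0 < w -> w <= w0 ->
    derive1 (fun t => ln (g_fun phi (l + 1 / 2) (expR t))) (ln w) <= 3 + 2 * l.
  by move=> wgt0 /(hn w wgt0); rewrite /polytropic_index; lra.
have [c1 c10 H1] := log_derivative_le_powR w00 g0 dg ga.
have [Ww0|w0W] := leP W w0.
  by exists c1 => // w wgt0 wW; apply: H1 => //; exact: le_trans Ww0.
have [|x] := @EVT_min _ (g_fun phi (l + 1 / 2)) w0 W (ltW w0W) _.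
  apply: continuous_in_subspaceT => t; rewrite inE /= in_itv/= => /andP[tw0 _].
  exact: is_derive_continuous (derivableP (dg _ (lt_le_trans w00 tw0))).
rewrite in_itv/= => /andP[xw0 _] Hx.
have gx0 : 0 < g_fun phi (l + 1 / 2) x by apply: g0; exact: lt_le_trans xw0.
have Wa0 : 0 < W `^ (3 + 2 * l) by exact: powR_gt0.
(* The second candidate divides the minimum of g on [[w0, W]] by the largest value there of the
   power, whose exponent is positive because [l > -1]. *)
exists (Num.min c1 (g_fun phi (l + 1 / 2) x / W `^ (3 + 2 * l))).
  by rewrite lt_min c10 divr_gt0.
move=> w wgt0 wW; have [ww0|w0w] := leP w w0.
  apply: le_trans (H1 w wgt0 ww0); rewrite ler_wpM2r ?powR_ge0//.
  by rewrite ge_min lexx.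
apply: (@le_trans _ _ (g_fun phi (l + 1 / 2) x)); last first.
  by apply: Hx; rewrite in_itv/= (ltW w0w).
rewrite -[leRHS](divfK (lt0r_neq0 Wa0)) ler_pM ?powR_ge0//.
- by rewrite le_min (ltW c10) divr_ge0 ?(ltW gx0) ?powR_ge0.
- by rewrite ge_min lexx orbT.
- by rewrite ge0_ler_powR ?nnegrE// ?(ltW wgt0) ?(ltW W0)//; lra.
Qed.

End lower_bound.

(** * The differential equations *)

Section ode.
Set Implicit Arguments.
Unset Strict Implicit.
Context {R : realType}.

Lemma is_derive_le0_nincr (f df : R -> R) (x y : R) : x <= y ->
  (forall t, x <= t -> t <= y -> is_derive t 1 f (df t)) ->
  (forall t, x <= t -> t <= y -> df t <= 0) -> f y <= f x.
Proof.
move=> xy dfE df0; have [| |t + E] := @MVT_segment _ f df x y xy.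
- by move=> t; rewrite in_itv/= => /andP[/ltW ? /ltW ?]; exact: dfE.
- apply: continuous_in_subspaceT => t; rewrite inE/= in_itv/= => /andP[? ?].
  exact: is_derive_continuous (dfE t _ _).
rewrite in_itv/= => /andP[xt ty]; rewrite -subr_le0 E.
by rewrite mulr_le0_ge0 ?subr_ge0// df0.
Qed.

Lemma is_derive_ge0_ndecr (f df : R -> R) (x y : R) : x <= y ->
  (forall t, x <= t -> t <= y -> is_derive t 1 f (df t)) ->
  (forall t, x <= t -> t <= y -> 0 <= df t) -> f x <= f y.
Proof.
move=> xy dfE df0; rewrite -lerN2.
apply: (@is_derive_le0_nincr (fun t => - f t) (fun t => - df t)) => // t xt ty.
  by apply: is_deriveN; exact: dfE.
by rewrite oppr_le0 df0.
Qed.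

(** * Impossibility of a solution existing at all large radii *)

Section global.
Variables (r0 K a : R) (m w dm : R -> R).
Hypotheses (r0_gt0 : 0 < r0) (K_gt0 : 0 < K) (a_gt1 : 1 < a).
Hypotheses (m_gt0 : forall r, r0 <= r -> 0 < m r) (w_gt0 : forall r, r0 <= r -> 0 < w r).
Hypotheses (m_ode : forall r, r0 <= r -> is_derive r 1 m (dm r))
  (w_ode : forall r, r0 <= r -> is_derive r 1 w (- (m r / r ^+ 2))).
Hypothesis dm_ge : forall r, r0 <= r -> K * r `^ (a - 1) * w r `^ a <= dm r.

Lemma m_ndecr (x y : R) : r0 <= x -> x <= y -> m x <= m y.
Proof.
move=> rx xy; apply: (@is_derive_ge0_ndecr _ dm) => // t xt _.
  by apply: m_ode; exact: le_trans xt.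
apply: le_trans (dm_ge _); last exact: le_trans xt.
by rewrite !mulr_ge0 ?powR_ge0// ltW.
Qed.

(** As [m t >= m r] for [t >= r], the function [w t - m r / t] is nonincreasing. Comparing [r] with
    a far radius [s], where [w s > 0], leaves only the error [m r / s], which tends to 0. *)
Lemma w_ge_potential (r : R) : r0 <= r -> m r / r <= w r.
Proof.
move=> rr; have r_gt0 : 0 < r by exact: lt_le_trans rr.
have bound s : r <= s -> m r / r - m r / s <= w r.
  move=> rs; have s_gt0 : 0 < s by exact: lt_le_trans rs.
  have : w s + - m r * s^-1 <= w r + - m r * r^-1.
    apply: (@is_derive_le0_nincr (fun t => w t + - m r * t^-1)
      (fun t => - (m t / t ^+ 2) + - m r * (- t ^- 2 *: 1))) => // t rt ts.
      have t_gt0 : 0 < t by exact: lt_le_trans rt.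
      apply: is_derive_add; first by apply: w_ode; exact: le_trans rt.
      by apply: is_derive_mulCl; apply: is_deriveV (is_derive_var t); rewrite gt_eqF.
    have -> : - t ^- 2 *: (1 : R) = - t ^- 2 by rewrite /GRing.scale/= mulr1.
    by rewrite mulrNN -mulNr -mulrDl mulr_le0_ge0 ?invr_ge0 ?sqr_ge0// addrC subr_le0 m_ndecr.
  have := w_gt0 (le_trans rr rs); rewrite !mulNr; lra.
rewrite leNgt; apply/negP => wm.
pose d := m r / r - w r; have d0 : 0 < d by rewrite subr_gt0.
have mr0 : 0 < m r by exact: m_gt0.
(* Any radius above both [r] and [m r / d] contradicts [bound], since then [m r / s < d]. *)
pose s := r + m r / d + m r / d.
have md0 : 0 < m r / d by rewrite divr_gt0.
have s0 : 0 < s by rewrite /s; lra.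
have : m r / s < d.
  rewrite ltr_pdivrMr// mulrC -ltr_pdivrMr// /s; lra.
have := bound s; rewrite /d; have -> : r <= s by rewrite /s; lra.
move=> /(_ isT); lra.
Qed.

Lemma no_global_solution : False.
Proof.
(* dm/dr >= K m ^ a / r makes h nonincreasing, while ln r is unbounded. *)
pose h (r : R) := m r `^ (1 - a) + (a - 1) * K * ln r.
have aK0 : 0 < (a - 1) * K by rewrite mulr_gt0// subr_gt0.
have h_nincr r : r0 <= r -> h r <= h r0.
  move=> rr; apply: (@is_derive_le0_nincr h
    (fun t => (1 - a) * m t `^ (1 - a - 1) * dm t + (a - 1) * K * t^-1)) => // t rt _.
    have t_gt0 : 0 < t by exact: lt_le_trans rt.
    exact: is_derive_add (is_derive_powR_comp (1 - a) (m_ode rt) (m_gt0 rt))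
      (is_derive_mulCl _ (is_derive1_ln t_gt0)).
  have t_gt0 : 0 < t by exact: lt_le_trans rt.
  have mt0 := m_gt0 rt.
  (* Inserting [w t >= m t / t] in [dm_ge] makes the powers of [t] collapse to [t ^ (-1)]. *)
  have dmt : K * (m t `^ a / t) <= dm t.
    apply: le_trans (dm_ge rt); rewrite -mulrA ler_wpM2l ?(ltW K_gt0)//.
    apply: (@le_trans _ _ (t `^ (a - 1) * (m t / t) `^ a)).
      rewrite powRM ?invr_ge0 ?(ltW mt0) ?(ltW t_gt0)// -powR_inv1 ?(ltW t_gt0)//.
      rewrite -powRrM mulN1r mulrCA -powRD ?(gt_eqF t_gt0) ?implybT//.
      by have -> : a - 1 - a = -1 by ring.
    rewrite ler_wpM2l ?powR_ge0// ge0_ler_powR ?nnegrE ?divr_ge0 ?(ltW mt0) ?(ltW t_gt0)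
      ?(ltW (w_gt0 rt)) ?(ltW (lt_trans ltr01 a_gt1))//.
    exact: w_ge_potential.
  have ma : m t `^ (1 - a - 1) * (K * (m t `^ a / t)) = K * t^-1.
    have -> : 1 - a - 1 = - a by ring.
    by rewrite powRN; field; rewrite ?gt_eqF ?powR_gt0.
  have := ler_wpM2l (powR_ge0 (m t) (1 - a - 1)) dmt; rewrite ma.
  have a10 : 0 <= a - 1 by rewrite subr_ge0 ltW.
  move=> /(ler_wpM2l a10) H.
  suff : (a - 1) * (K / t) <= (a - 1) * (m t `^ (1 - a - 1) * dm t) by rewrite !mulrA; lra.
  exact: H.
(* At [r0 * expR T] the logarithmic term alone exceeds [h r0], and the remaining term of [h] is
   nonnegative. *)
pose T := `|h r0| / ((a - 1) * K) + `|ln r0| + 1.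
have T0 : 0 <= T by rewrite !addr_ge0 ?divr_ge0// ltW.
have r0T : r0 <= r0 * expR T by rewrite ler_peMr ?(ltW r0_gt0)// -expR0 ler_expR.
have := h_nincr _ r0T; rewrite /h lnM ?posrE ?expR_gt0// expRK -/(h r0).
apply/negP; rewrite -ltNge.
apply: (@lt_le_trans _ _ ((a - 1) * K * (ln r0 + T))); last by rewrite lerDr powR_ge0.
apply: le_lt_trans (ler_norm _) _.
rewrite mulrC -ltr_pdivrMr// /T.
have := ler_norm (- ln r0); rewrite normrN; lra.
Qed.

End global.

(** The weight [2 * K / (b + 1)] makes the derivative of the second term of [h] equal to
    [- 2 * m * K * w ^ b / r ^ 2], which compensates the upper bound on [2 * m * dm]. That term is
    nonnegative since [b > -1], so [m ^ 2 <= h r0]. *)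
Lemma mass_bounded (r0 r1 K b : R) (m w dm : R -> R) : r0 < r1 -> -1 < b -> 0 <= K ->
  (forall r, r0 <= r -> r < r1 -> 0 < m r) -> (forall r, r0 <= r -> r < r1 -> 0 < w r) ->
  (forall r, r0 <= r -> r < r1 -> is_derive r 1 m (dm r)) ->
  (forall r, r0 <= r -> r < r1 -> is_derive r 1 w (- (m r / r ^+ 2))) ->
  (forall r, r0 <= r -> r < r1 -> dm r <= K * w r `^ b / r ^+ 2) ->
  exists B, forall r, r0 <= r -> r < r1 -> m r <= B.
Proof.
move=> r01 b1 K0 m_gt0 w_gt0 m_ode w_ode dm_le.
have b10 : 0 < b + 1 by lra.
pose h (r : R) := m r * m r + 2 * K / (b + 1) * w r `^ (b + 1).
(* The inequality [m <= m ^ 2 + 1] avoids taking a square root. *)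
exists (h r0 + 1) => r r0r rr1.
have : h r <= h r0.
  apply: (@is_derive_le0_nincr h (fun t => (m t * dm t + m t * dm t) +
      2 * K / (b + 1) * ((b + 1) * w t `^ (b + 1 - 1) * - (m t / t ^+ 2)))) => // t r0t tr.
    have tr1 := le_lt_trans tr rr1.
    exact: is_derive_add (is_derive_mul (m_ode t r0t tr1) (m_ode t r0t tr1))
      (is_derive_mulCl _ (is_derive_powR_comp (b + 1) (w_ode t r0t tr1) (w_gt0 t r0t tr1))).
  have tr1 := le_lt_trans tr rr1.
  have := ler_wpM2l (ltW (m_gt0 t r0t tr1)) (dm_le t r0t tr1).
  rewrite addrK.
  have -> : 2 * K / (b + 1) * ((b + 1) * w t `^ b * - (m t / t ^+ 2)) =
    - 2 * (m t * (K * w t `^ b / t ^+ 2)).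
    rewrite [_ / t ^+ 2 in LHS]mulrC [_ / t ^+ 2 in RHS]mulrC.
    by set z := (t ^+ 2)^-1; field; rewrite gt_eqF.
  by set x := m t * dm t; set y := m t * _; lra.
move=> hr; apply: (@le_trans _ _ (h r + 1)); last by rewrite lerD2r.
rewrite /h;
  have : 0 <= 2 * K / (b + 1) * w r `^ (b + 1) by rewrite !mulr_ge0 ?powR_ge0 ?invr_ge0 ?(ltW b10).
set x := _ * w r `^ _; set y := m r; nra.
Qed.

End ode.

(** * Radius and mass of a solution of the system *)

Section solutions.
Set Implicit Arguments.
Unset Strict Implicit.
Context {R : realType}.
Variables (l : R) (phi : R -> R).
Hypotheses (hl : -1 < l) (hphi : regular_phi l phi).
Variables (J : set R) (m w : R -> R).
Hypothesis sol : solution l phi J m w.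
Hypothesis hg : forall w, 0 < w -> 0 < g_fun phi (l + 1 / 2) w.

Lemma between_radii_interior (x y r : R) : J x -> J y -> x < r -> r < y -> J° r.
Proof.
move=> Jx Jy xr ry; have : `]x, y[%classic `<=` J°.
  rewrite -open_subsetE; last exact: itv_open.
  move=> z; rewrite /= in_itv/= => /andP[xz zy].
  by apply: (sol_interval sol Jx Jy); rewrite !ltW.
by apply; rewrite /= in_itv/= xr.
Qed.

(** Without a bound on [J] the equations hold at all large radii, and [g_fun_ge] turns the mass
    equation into the inequality [dm_ge] with [a = 3 + 2 * l]; the factor [r ^ (2 + 2 * l)] there is
    [r ^ (a - 1)]. *)
Lemma unbounded_radii_absurd :
  (exists2 w0 : R, 0 < w0 &
     forall w : R, 0 < w -> w <= w0 -> polytropic_index l phi w <= 3 + l) ->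
  ~ has_ubound J -> False.
Proof.
move=> hn nubJ.
have [r0 /interior_subset Jr0] := sol_nondegenerate sol.
have Jint r : r0 < r -> J° r.
  move=> r0r; have [y Jy ry] : exists2 y, J y & r < y.
    apply: contrapT => H; apply: nubJ; exists r => y Jy.
    by rewrite leNgt; apply/negP => ry; apply: H; exists y.
  exact: (between_radii_interior Jr0 Jy).
have r0_gt0 := sol_radii sol Jr0.
pose r1 := r0 + 1.
have Jr r : r1 <= r -> J° r by move=> r1r; apply: Jint; rewrite /r1 in r1r; lra.
have r1_gt0 : 0 < r1 by rewrite addr_gt0.
have JJ r : r1 <= r -> J r by move=> /Jr /interior_subset.
have W0 := sol_w_gt0 sol (JJ r1 (lexx r1)).
have [c c0 gc] := g_fun_ge hl hphi hg hn W0.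
have C0 := C_const_gt0 hl.
(* Since [w] decreases, the lower bound on g over []0, w r1]] applies along the whole solution. *)
have w_le r : r1 <= r -> w r <= w r1.
  move=> r1r; apply: (@is_derive_le0_nincr _ w (fun t => - (m t / t ^+ 2))) => // t r1t _.
    exact: (sol_w_ode sol (Jr _ r1t)).
  by rewrite oppr_le0 divr_ge0 ?sqr_ge0// ltW// (sol_m_gt0 sol (JJ _ r1t)).
apply: (@no_global_solution _ r1 (4 * pi * C_const l * c) (3 + 2 * l) m w
  (fun r => 4 * pi * r ^+ 2 * rho l phi r (w r))) => //.
- by do 3 (apply: mulr_gt0 => //); exact: pi_gt0.
- by move: hl; lra.
- by move=> r /JJ; exact: (sol_m_gt0 sol).
- by move=> r /JJ; exact: (sol_w_gt0 sol).
- by move=> r /Jr; exact: (sol_m_ode sol).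
- by move=> r /Jr; exact: (sol_w_ode sol).
- move=> r r1r; have r_gt0 : 0 < r by exact: lt_le_trans r1r.
  have := gc (w r) (sol_w_gt0 sol (JJ _ r1r)) (w_le _ r1r).
  rewrite /rho; have -> : 3 + 2 * l - 1 = 2%:R + 2 * l by ring.
  rewrite [r `^ (2%:R + _)]powRD ?(gt_eqF r_gt0) ?implybT// powR_mulrn ?(ltW r_gt0)//.
  have D0 : 0 <= 4 * pi * C_const l * r ^+ 2 * r `^ (2 * l).
    apply: mulr_ge0; last exact: powR_ge0.
    apply: mulr_ge0; last exact: sqr_ge0.
    by apply: mulr_ge0; [rewrite mulr_ge0 ?pi_ge0|exact: ltW].
  move=> /(ler_wpM2l D0).
  set X := _ `^ (3 + 2 * l); set g := g_fun _ _ _ => H.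
  apply: le_trans (le_trans H _); rewrite le_eqVlt; apply/orP; left; apply/eqP; ring.
Qed.

(** Near [sup J] the mass is nondecreasing, and [mass_bounded] with the upper power bound on g keeps
    it bounded, so its left limit exists. *)
Lemma bounded_radii_finite_mass : has_ubound J ->
  exists M : R, m r @[r --> (sup J)^'-] --> M.
Proof.
move=> ubJ.
have [r0 intr0] := sol_nondegenerate sol; have Jr0 := interior_subset intr0.
have r0_gt0 := sol_radii sol Jr0.
have Jint r : r0 < r -> r < sup J -> J° r.
  move=> r0r rs; have [y Jy ry] := sup_gt (ex_intro _ _ Jr0) rs.
  exact: (between_radii_interior Jr0 Jy).
(* The point [r0] is interior to [J], so [J] contains radii strictly beyond it. *)
have r0_sup : r0 < sup J.
  have [e /= e0 He] := intr0.
  apply: (@lt_le_trans _ _ (r0 + e / 2)); first by rewrite ltrDl divr_gt0.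
  apply: ub_le_sup => //; apply: He; rewrite /ball/=.
  by rewrite opprD addrA subrr sub0r normrN gtr0_norm ?divr_gt0// ltr_pdivrMr// ltr_pMr// ltr1n.
pose r1 := (r0 + sup J) / 2.
have r01 : r0 < r1 by rewrite /r1; lra.
have r1s : r1 < sup J by rewrite /r1; lra.
have Jr r : r1 <= r -> r < sup J -> J° r by move=> r1r; apply: Jint; exact: lt_le_trans r1r.
have JJ r : r1 <= r -> r < sup J -> J r by move=> r1r rs; exact: interior_subset (Jr _ r1r rs).
have r1_gt0 : 0 < r1 by exact: lt_trans r01.
have s_gt0 : 0 < sup J by exact: lt_trans r1s.
have W0 := sol_w_gt0 sol (JJ r1 (lexx r1) r1s).
have C0 := C_const_gt0 hl.
have p1 : -1 < l + 1 / 2 by move: hl; lra.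
have [k k1 H] := g_fun_le hphi p1.
have [c c0 gc] := H _ W0.
have w_le r : r1 <= r -> r < sup J -> w r <= w r1.
  move=> r1r rs; apply: (@is_derive_le0_nincr _ w (fun t => - (m t / t ^+ 2))) => // t r1t tr.
    exact: (sol_w_ode sol (Jr _ r1t (le_lt_trans tr rs))).
  by rewrite oppr_le0 divr_ge0 ?sqr_ge0// ltW// (sol_m_gt0 sol (JJ _ r1t (le_lt_trans tr rs))).
pose dm r := 4 * pi * r ^+ 2 * rho l phi r (w r).
have D0 : 0 <= 4 * pi * C_const l by apply: mulr_ge0; [rewrite mulr_ge0 ?pi_ge0|exact: ltW].
have [B mB] : exists B, forall r, r1 <= r -> r < sup J -> m r <= B.
  (* To produce the denominator [r ^ 2], the factor [r ^ (2 + 2 * l)] is written as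
     [r ^ (4 + 2 * l) / r ^ 2] and its numerator bounded by the value at [sup J]. *)
  apply: (@mass_bounded _ r1 (sup J)
    (4 * pi * C_const l * (sup J) `^ (4 + 2 * l) * c) (k + (l + 1 / 2) + 1) m w dm) => //.
  - by lra.
  - by apply: mulr_ge0 => //; apply: mulr_ge0 => //; exact: powR_ge0.
  - by move=> r r1r rs; exact: (sol_m_gt0 sol (JJ _ r1r rs)).
  - by move=> r r1r rs; exact: (sol_w_gt0 sol (JJ _ r1r rs)).
  - by move=> r r1r rs; exact: (sol_m_ode sol (Jr _ r1r rs)).
  - by move=> r r1r rs; exact: (sol_w_ode sol (Jr _ r1r rs)).
  - move=> r r1r rs; have r_gt0 : 0 < r by exact: lt_le_trans r1r.
    have [_ gr] := gc (w r) (sol_w_gt0 sol (JJ _ r1r rs)) (w_le _ r1r rs).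
    rewrite ler_pdivlMr ?exprn_gt0// /dm /rho.
    move: gr; set X := w r `^ _; set g := g_fun _ _ _ => gr.
    have -> : 4 * pi * r ^+ 2 * (C_const l * r `^ (2 * l) * g) * r ^+ 2 =
        4 * pi * C_const l * (r `^ (4%:R + 2 * l) * g).
      by rewrite powRD ?(gt_eqF r_gt0) ?implybT// powR_mulrn ?(ltW r_gt0)//; ring.
    rewrite -[leRHS]mulrA -[leRHS]mulrA ler_wpM2l//.
    apply: (@le_trans _ _ (r `^ (4 + 2 * l) * (c * X))).
      by rewrite ler_wpM2l ?powR_ge0.
    rewrite ler_wpM2r ?mulr_ge0 ?powR_ge0// ge0_ler_powR ?nnegrE ?ltW//; move: hl; lra.
apply/cvg_ex; apply: nondecreasing_at_left_is_cvgr.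
- near=> x => y z; rewrite !in_itv/= => /andP[xy ys] /andP[xz zs] yz.
  have r1x : r1 <= x by near: x; exact: nbhs_left_ge.
  have r1y : r1 <= y by exact: le_trans (ltW xy).
  apply: (@is_derive_ge0_ndecr _ m dm) => // t yt tz.
    exact: (sol_m_ode sol (Jr _ (le_trans r1y yt) (le_lt_trans tz zs))).
  have Jt := JJ _ (le_trans r1y yt) (le_lt_trans tz zs).
  apply: mulr_ge0; first by apply: mulr_ge0; [rewrite mulr_ge0 ?pi_ge0|exact: sqr_ge0].
  apply: mulr_ge0; first by apply: mulr_ge0; [exact: ltW | exact: powR_ge0].
  by apply/ltW/hg; exact: (sol_w_gt0 sol Jt).
- near=> x; exists B => z [y /=]; rewrite in_itv/= => /andP[xy ys] <-.
  apply: mB => //; apply: le_trans (ltW xy); near: x; exact: nbhs_left_ge.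
Unshelve. all: by end_near.
Qed.

End solutions.

(** * Finiteness of the radius and of the mass *)

Theorem theorem5p1 (R : realType) (l : R) (phi : R -> R)
  (hl : -1 < l)
  (hphi : regular_phi l phi)
  (hg : forall w : R, 0 < w -> 0 < g_fun phi (l + 1 / 2) w)
  (hn : exists2 w0 : R, 0 < w0 &
     forall w : R, 0 < w -> w <= w0 -> polytropic_index l phi w <= 3 + l) :
  forall (J : set R) (m w : R -> R), associated_solution l phi J m w ->
    exists Rad : R, solution_radius J = Rad%:E /\
      exists M : R, m r @[r --> Rad^'-] --> M.
Proof.
move=> J m w [sol _].
have ubJ : has_ubound J.
  by apply: contrapT => /(unbounded_radii_absurd hl hphi sol hg hn).
have [r0 /interior_subset Jr0] := sol_nondegenerate sol.
exists (sup J); split; first by apply: ereal_sup_EFin => //; exists r0.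
exact: (bounded_radii_finite_mass hl hphi sol hg ubJ).
Qed.
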